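(* Let $\pi$ be a permutation of length $k \geq 3$, and suppose that $|\pi^{-1}(1) - \pi^{-1}(k)| = 1$. Then the query complexity of any non-adaptive one-sided $\varepsilon$-test for $\pi$-freeness is $\Omega\!\left(\varepsilon^{-\frac{1}{k-1}}n^{1 - \frac{1}{k-1}}\right)$.
   Context: A permutation $\pi=(\pi_1,\dots,\pi_k)$ of $[k]$ is viewed as a sequence. A sequence $f\colon[n]\to\mathbb{R}$ contains $\pi$ if there exist indices $i_1<\dots<i_k$ in $[n]$ such that for all $a,b$, $f(i_a)<f(i_b)$ iff $\pi_a<\pi_b$; otherwise $f$ is $\pi$-free. $f$ is $\varepsilon$-far from $\pi$-freeness if one must change more than $\varepsilon n$ values of $f$ to make it $\pi$-free. A one-sided $\varepsilon$-test for $\pi$-freeness is a randomized algorithm with query access to $f\colon[n]\to\mathbb{R}$ that always accepts $\pi$-free $f$ and rejects with probability at least $2/3$ every $f$ that is $\varepsilon$-far from $\pi$-freeness; it is non-adaptive if all its queries are chosen (possibly at random) before any answer is received. Query complexity is the maximum number of queries. Asymptotic notation is in terms of $n$ and $\varepsilon$, with $k$ regarded as a constant (hidden constants may depend on $k$). *)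

(* Defs.v *)
From HB Require Import structures.
From mathcomp Require Import all_boot all_order fingroup perm all_algebra.
From mathcomp Require Import all_classical all_reals all_analysis.

Set Implicit Arguments.
Unset Strict Implicit.
Unset Printing Implicit Defensive.

Import Order.TTheory GRing.Theory Num.Theory.
Local Open Scope classical_set_scope.
Local Open Scope ring_scope.

(* Positions and values are numbered from 0: a permutation of [k] is s : 'S_k,
   with the smallest value 0 and the largest value k.-1. *)

Definition contains (R : realType) (n k : nat) (s : 'S_k) (f : 'I_n -> R) :
    Prop :=
  exists i : 'I_k -> 'I_n,
    (forall a b : 'I_k, (a < b)%N -> (i a < i b)%N) /\
    (forall a b : 'I_k, (f (i a) < f (i b)) <-> (s a < s b)%N).

Definition pattern_free (R : realType) (n k : nat) (s : 'S_k)
    (f : 'I_n -> R) : Prop :=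
  ~ contains s f.

Definition far_from_free (R : realType) (n k : nat) (s : 'S_k) (eps : R)
    (f : 'I_n -> R) : Prop :=
  forall g : 'I_n -> R, pattern_free s g ->
    eps * n%:R < #|[pred i | f i != g i]|%:R.

Definition extremes_adjacent (k : nat) (s : 'S_k) : Prop :=
  exists lo hi : 'I_k,
    [/\ lo = 0%N :> nat, hi = k.-1 :> nat &
        `|(s^-1)%g lo - (s^-1)%g hi|%N = 1%N].

(* The randomness is a point w of an arbitrary probability space. Since queries
   does not take f as an argument, the test is non-adaptive; accepts only sees
   w and the list of answers to the queries, in the order of the queries. *)
Record nonadaptive_test (R : realType) (n : nat) := NonadaptiveTest {
  coin_display : measure_display;
  coin : measurableType coin_display;
  coin_law : probability coin R;
  queries : coin -> seq 'I_n;
  accepts : coin -> seq R -> bool;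
  measurable_queries : forall q : seq 'I_n,
    measurable [set w | queries w = q];
  measurable_accepts : forall f : 'I_n -> R,
    measurable [set w | accepts w (map f (queries w))]
}.

Definition accept_event (R : realType) (n : nat) (t : nonadaptive_test R n)
    (f : 'I_n -> R) : set (coin t) :=
  [set w | accepts w (map f (queries w))].
Arguments accept_event {R n} t f.

Definition one_sided_test (R : realType) (n k : nat) (s : 'S_k) (eps : R)
    (t : nonadaptive_test R n) : Prop :=
  (forall f : 'I_n -> R, pattern_free s f ->
     coin_law t (accept_event t f) = 1%E) /\
  (forall f : 'I_n -> R, far_from_free s eps f ->
     ((2 / 3 : R)%:E <= coin_law t (~` accept_event t f))%E).

Definition query_complexity (R : realType) (n : nat)
    (t : nonadaptive_test R n) : \bar R :=
  ereal_sup [set ((size (queries w))%:R : R)%:E | w in [set: coin t]].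

(* Main.v *)
Require Import Defs.
From mathcomp Require Import all_boot all_order fingroup perm all_algebra.
From mathcomp Require Import all_classical all_reals all_analysis.
From mathcomp Require Import measurable_realfun zify ring lra.

(** A one-sided test can only reject when its queries contain a copy of the
    pattern: otherwise the answers extend, by repeating the nearest query to the
    left, to a pattern-free function. It therefore suffices to exhibit a family of
    far functions such that every small query set contains a copy for few members.

    Write [p], [p + 1] for the positions of the extreme values of [s]. The domain is
    cut into [k - 1] blocks; block [p] hosts entries [p] and [p + 1], every other
    block hosts one entry. The value at a point is [k * level + digit], where the
    level is monotone on each block [b], in the direction opposite to
    [(s b, s (b + 1))], and the digit is the hosted value of [s]. By the choice of
    directions no block [b <> p] contains both entries [b] and [b + 1] of a copy,
    which forces entries [p] and [p + 1] of the copy into block [p], on the same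
    level. As these are the extreme values, the whole copy lies on that level, and
    hence meets every block. Shifting the levels of the blocks independently by
    [r b < M], with [M] of order [n], and arranging the pairs of block [p] correctly
    only inside a random window of length [w] of order [eps * n], leaves [w] disjoint
    copies, while [q] queries contain a copy for at most [q ^ (k - 1) * w] of the
    [M ^ (k - 1)] shifts. *)

Set Implicit Arguments.
Unset Strict Implicit.
Unset Printing Implicit Defensive.

Import Order.TTheory GRing.Theory Num.Theory.
Local Open Scope ring_scope.

(** * Extending answers without a copy to a pattern-free function *)

Definition contains_in (R : realType) (n k : nat) (s : 'S_k) (f : 'I_n -> R)
    (Q : seq 'I_n) : Prop :=
  exists i : 'I_k -> 'I_n,
    [/\ forall a b : 'I_k, (a < b)%N -> (i a < i b)%N,
        forall a b : 'I_k, (f (i a) < f (i b)) <-> (s a < s b)%N &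
        forall a, i a \in Q].

Lemma monotone_retraction (n : nat) (Q : seq 'I_n) (q : 'I_n) : q \in Q ->
  exists phi : 'I_n -> 'I_n,
    [/\ forall x, phi x \in Q, forall x, x \in Q -> phi x = x &
        forall x y : 'I_n, (x <= y)%N -> (phi x <= phi y)%N].
Proof.
move=> qQ.
have [q0 q0Q q0min] : exists2 q0, q0 \in Q & forall y, y \in Q -> (q0 <= y)%N.
  case: (arg_minnP (P := fun y => y \in Q) (fun y : 'I_n => y : nat) qQ) => q0.
  by exists q0.
(* Points left of every query are sent to the least query [q0]; the [maxn] keeps the candidate set
   nonempty. *)
pose P (x y : 'I_n) := (y \in Q) && (y <= maxn x q0)%N.
have Pq0 x : P x q0 by rewrite /P q0Q leq_maxr.
exists (fun x => [arg max_(y > q0 | P x y) (y : nat)]%N); split=> [x|x xQ|x y xy].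
- by case: arg_maxnP => // y /andP[].
- case: arg_maxnP => // y /andP[yQ yx] ymax.
  have xmax : (x <= y)%N by apply: ymax; rewrite /P xQ leq_maxl.
  apply/val_inj/eqP; rewrite eqn_leq xmax andbT.
  by have := q0min _ xQ; move: yx => /=; lia.
- case: arg_maxnP => // x' /andP[xQ' xx'] _; case: arg_maxnP => // y' _; apply.
  by rewrite /P xQ'; lia.
Qed.

Lemma perm_ltn_neq (k : nat) (s : 'S_k) (a b : 'I_k) :
  a != b -> (s a < s b)%N || (s b < s a)%N.
Proof.
by move=> ab; rewrite -neq_ltn; apply: contra ab => /eqP/val_inj/perm_inj ->.
Qed.

(** Precomposing [f] with the retraction onto [Q] pushes any copy into [Q]. Its indices stay
    distinct there, since collapsed indices would carry equal values. *)
Lemma free_extension (R : realType) (n k : nat) (s : 'S_k) (f : 'I_n -> R)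
    (Q : seq 'I_n) : (1 < k)%N -> ~ contains_in s f Q ->
  exists2 g : 'I_n -> R, pattern_free s g & {in Q, f =1 g}.
Proof.
move=> k1 nQ; case: Q nQ => [_|q Q nQ].
  (* Without queries there is nothing to retract onto; a constant function avoids every pattern of
     length at least two. *)
  exists (fun=> 0) => //; case=> i [_ iP].
  have : Ordinal (ltnW k1) != Ordinal k1 by [].
  by move=> /(perm_ltn_neq s)/orP[] /iP; rewrite ltxx.
have [phi [phiQ phiK phi_mono]] := monotone_retraction (mem_head q Q).
exists (f \o phi) => [[i [iinc iord]]|x xQ]; last by rewrite /= phiK.
apply: nQ; exists (phi \o i); split=> [a b ab|a b|a] /=; last exact: phiQ.
- have := phi_mono _ _ (ltnW (iinc _ _ ab)); rewrite leq_eqVlt => /orP[/eqP e|//].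
  have : a != b by rewrite neq_ltn ab.
  move=> /(perm_ltn_neq s)/orP[] /iord /=; rewrite (val_inj e) ltxx //.
- exact: iord.
Qed.

(** * From one-sided tests to counting copies seen by query sets *)

Section Averaging.
Context (R : realType) (n k : nat) (s : 'S_k) (eps : R) (t : nonadaptive_test R n).
Hypotheses (k1 : (1 < k)%N) (st : one_sided_test s eps t).
Local Open Scope classical_set_scope.

Definition sees_copy (f : 'I_n -> R) : set (coin t) :=
  [set w | contains_in s f (queries w)].

(** There are only countably many query lists, so the event is a countable union of the measurable
    fibres of [queries]. *)
Lemma measurable_queries_pred (P : seq 'I_n -> Prop) :
  measurable [set w : coin t | P (queries w)].
Proof.
pose D (o : option (seq 'I_n)) : set (coin t) :=
  if o is Some q then [set w | queries w = q /\ P q] else set0.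
have mD o : measurable (D o).
  case: o => [q|] /=; last exact: measurable0.
  have [Pq|nPq] := pselect (P q).
    rewrite (_ : mkset _ = [set w | queries w = q]); first exact: measurable_queries.
    by apply/seteqP; split => w //= [].
  rewrite (_ : mkset _ = set0); first exact: measurable0.
  by apply/seteqP; split => w //= [].
rewrite (_ : mkset _ = \bigcup_(j in [set: nat]) D (unpickle j)).
  by apply: bigcup_measurable => j _; exact: mD.
apply/seteqP; split => w /=.
  move=> Pw; exists (pickle (queries w)) => //.
  by have : D (unpickle (pickle (queries w))) w by rewrite pickleK.
have DP o : D o w -> P (queries w) by case: o => //= q [<-].
by case=> j _ wj; exact: (DP (unpickle j)).
Qed.

(** For a fixed query list without a copy, [f] gets the same answers as a pattern-free [g], so
    rejecting [f] lies in the null event of rejecting [g]. Countably many lists give one null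
    event. *)
Lemma reject_le_sees_copy (f : 'I_n -> R) :
  (coin_law t (~` accept_event t f) <= coin_law t (sees_copy f))%E.
Proof.
have macc g : measurable (accept_event t g) by exact: measurable_accepts.
pose D (o : option (seq 'I_n)) : set (coin t) := if o is Some q then
  [set w | [/\ queries w = q, ~ contains_in s f q & ~ accept_event t f w]]
  else set0.
have D0 o : (coin_law t).-negligible (D o).
  case: o => [q|] /=; last exact: negligible_set0.
  have [cq|ncq] := pselect (contains_in s f q).
    by apply: (negligibleS _ (negligible_set0 _)) => w [].
  have [g gfree gf] := free_extension k1 ncq.
  exists (~` accept_event t g); split.
  - exact: measurableC.
  - by have := probability_setC (coin_law t) (macc g); rewrite (st.1 _ gfree) subee.
  - move=> w [wq _]; apply: contra_not; rewrite /accept_event /= wq.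
    by congr (is_true (accepts w _)); apply/esym/eq_in_map.
have [A [mA A0 DA]] := negligible_bigcup (fun j => D0 (unpickle j)).
have msees : measurable (sees_copy f) by exact: measurable_queries_pred.
apply: (@le_trans _ _ (coin_law t (sees_copy f `|` A))).
  apply: le_measure; rewrite ?inE; [exact: measurableC|exact: measurableU|].
  move=> w rw; have [|nc] := pselect (contains_in s f (queries w)); first by left.
  right; apply: DA; exists (pickle (queries w)) => //.
  by have : D (unpickle (pickle (queries w))) w by rewrite pickleK.
apply: (le_trans (measureU2 _ msees mA)).
by rewrite [X in (_ + X)%E]A0 adde0.
Qed.

(** Double counting: the probabilities of seeing a copy, each at least 2/3, sum to the expected
    number of members in which a copy is seen. *)
Lemma far_family_averaging (I : finType) (F : I -> 'I_n -> R) (B : R) :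
  (forall i, far_from_free s eps (F i)) ->
  (forall w : coin t, #|[pred i | `[<contains_in s (F i) (queries w)>]]|%:R <= B) ->
  2 / 3 * #|I|%:R <= B.
Proof.
move=> Ffar FB.
have mE i : measurable (sees_copy (F i)) by exact: measurable_queries_pred.
have sumE : (\sum_(i : I) coin_law t (sees_copy (F i)) <= B%:E)%E.
  under eq_bigr => i _ do
    rewrite -(setIT (sees_copy (F i))) -integral_indic //.
  rewrite -ge0_integral_sum //=; last first.
    by move=> i; apply/measurable_EFinP; exact: measurable_indic.
  apply: (@le_trans _ _ (\int[coin_law t]_(x in setT) (cst B%:E) x)%E).
    apply: ge0_le_integral => //=.
    - by move=> x _; apply: sume_ge0 => i _; rewrite lee_fin.
    - apply: emeasurable_sum => i; apply/measurable_EFinP; exact: measurable_indic.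
    - move=> x _; rewrite sumEFin lee_fin; apply: le_trans (FB x).
      rewrite -sum1_card natr_sum big_mkcond /= [leRHS]big_mkcond /=.
      apply: ler_sum => i _; rewrite indicE !inE; case: asboolP => h.
        by rewrite mem_set.
      by rewrite memNset.
  by rewrite integral_cst //= probability_setT mule1.
rewrite -lee_fin; apply: le_trans sumE.
rewrite mulr_natr -sumr_const -sumEFin.
apply: lee_sum => i _; apply: le_trans (reject_le_sees_copy _).
exact: st.2.
Qed.

End Averaging.

(** * The hard functions: levels and digits in base [k] *)

Lemma digit_lt (k : nat) (u v : int) (a b : nat) :
  (a < k)%N -> u < v -> k%:Z * u + a%:Z < k%:Z * v + b%:Z.
Proof. by nia. Qed.

Lemma digit_range (k : nat) (u v : int) (a : nat) : (a < k)%N ->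
  k%:Z * v <= k%:Z * u + a%:Z < k%:Z * v + k%:Z -> u = v.
Proof. by nia. Qed.

Section HardFunctions.
Context (K : nat) (s : 'S_K.+2) (p M w : nat).

Definition entry (a : nat) : nat := s (inord a).

Hypothesis pK : (p < K.+1)%N.
Hypothesis M0 : (0 < M)%N.

Definition dir (b : nat) : int := if (entry b.+1 < entry b)%N then 1 else -1.
(** The minimum assigns the leftover positions at the end of the domain to the last block. *)
Definition block (x : nat) : nat := minn (x %/ (3 * M)) K.
Definition slot (x : nat) : nat := (x - block x * (3 * M))%N.

Definition level (r : nat -> nat) (x : nat) : int :=
  dir (block x) * (if block x == p then (slot x)./2%:Z
                   else (slot x)%:Z - M%:Z - (r (block x))%:Z).

(* Pair number [m] of block [p] is active if it lies in the same window of
   length [w] as [r p]; an inactive pair has its two values swapped. *)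
Definition active (r : nat -> nat) (m : nat) : bool := (m %/ w == r p %/ w)%N.

Definition digit (r : nat -> nat) (x : nat) : nat :=
  if block x == p then
    (if odd (slot x) (+) active r (slot x)./2 then entry p else entry p.+1)
  else if (block x < p)%N then entry (block x) else entry (block x).+1.

Definition hard (r : nat -> nat) (x : nat) : int :=
  K.+2%:Z * level r x + (digit r x)%:Z.

Lemma entry_lt a : (entry a < K.+2)%N.
Proof. exact: ltn_ord. Qed.

Lemma entry_inj a b : (a < K.+2)%N -> (b < K.+2)%N -> entry a = entry b -> a = b.
Proof.
by move=> aK bK /val_inj/perm_inj/(congr1 val) /=; rewrite !inordK.
Qed.

Lemma entryS_neq b : (b < K.+1)%N -> entry b <> entry b.+1.
Proof. by move=> bK /entry_inj; lia. Qed.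

Lemma digit_ltK r x : (digit r x < K.+2)%N.
Proof. by rewrite /digit; do ?case: ifP => _; exact: entry_lt. Qed.

Lemma dir_cases b : dir b = 1 \/ dir b = -1.
Proof. by rewrite /dir; case: ifP; [left | right]. Qed.

Lemma block_le x : (block x <= K)%N.
Proof. exact: geq_minr. Qed.

Lemma block_mono x y : (x <= y)%N -> (block x <= block y)%N.
Proof. by move=> xy; have := leq_div2r (3 * M) xy; rewrite /block; lia. Qed.

Lemma slotE x : x = (block x * (3 * M) + slot x)%N.
Proof.
rewrite /slot subnKC // (leq_trans _ (leq_divM x (3 * M))) // leq_mul2r.
by rewrite geq_minl orbT.
Qed.

Lemma block_slot b y : (b <= K)%N -> (y < 3 * M)%N ->
  block (b * (3 * M) + y) = b /\ slot (b * (3 * M) + y) = y.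
Proof.
move=> bK yM; have e : block (b * (3 * M) + y) = b.
  by rewrite /block divnMDl ?divn_small ?addn0 ?(minn_idPl bK) // muln_gt0.
by split=> //; rewrite /slot e addKn.
Qed.

Lemma slot_lt x y : block x = block y -> (x < y)%N -> (slot x < slot y)%N.
Proof. by move=> e; rewrite {1}(slotE x) {1}(slotE y) e ltn_add2l. Qed.

(** A strict change of level outweighs the digits. In block [p] the two points of a pair share a
    level, hence the additional hypothesis there. *)
Lemma hard_block_lt r x y : block x = block y -> (x < y)%N ->
  (block x == p -> (slot x)./2 < (slot y)./2)%N ->
  if (entry (block x).+1 < entry (block x))%N then hard r x < hard r y
  else hard r y < hard r x.
Proof.
move=> e xy h; have sxy := slot_lt e xy.
case: ifP => hb; apply: digit_lt; rewrite ?digit_ltK //;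
  rewrite /level -e /dir hb; case: ifP => [/h|_]; lia.
Qed.

Definition copy (r j : nat -> nat) : Prop :=
  (forall a b, (a < b < K.+2)%N -> (j a < j b)%N) /\
  (forall a b, (a < K.+2)%N -> (b < K.+2)%N ->
    (hard r (j a) < hard r (j b)) <-> (entry a < entry b)%N).

(** * Planted copies, one on each active level *)

Section Planted.
Context (r : nat -> nat) (r_lt : forall b, (r b < M)%N).

Definition host (a : nat) : nat := if (a <= p)%N then a else a.-1.

(** Outside block [p] the slot solves [level = dir p * m]; as [m] and the shifts are below [M], the
    offset [M] and the block length [3 * M] keep it inside the block. *)
Definition planted (m a : nat) : nat :=
  (host a * (3 * M) + (if host a == p then m.*2 + (a == p.+1)
     else absz (M%:Z + (r (host a))%:Z + dir (host a) * dir p * m%:Z)%R))%N.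

Lemma planted_spec m a : (m < M)%N -> (a < K.+2)%N ->
  [/\ block (planted m a) = host a, level r (planted m a) = dir p * m%:Z &
      active r m -> digit r (planted m a) = entry a].
Proof.
move=> mM aK; have hK : (host a <= K)%N by rewrite /host; case: ifP; lia.
have rM := r_lt (host a).
rewrite /planted; case: (eqVneq (host a) p) => hp.
  have [] := @block_slot (host a) (m.*2 + (a == p.+1)) hK; first lia.
  move=> eb es; split; first exact: eb.
    by rewrite /level eb es hp eqxx; congr (_ * Posz _); lia.
  move=> act; rewrite /digit eb es hp eqxx.
  have -> : (m.*2 + (a == p.+1))./2 = m by lia.
  rewrite act; move: hp; rewrite /host; case: ifP => ap; last first.
    by move=> e; rewrite (_ : a = p.+1) ?eqxx ?oddD ?odd_double //; lia.
  by move=> ->; rewrite oddD odd_double eqn_leq ltnn andbF.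
set y := absz _; have [] := @block_slot (host a) y hK.
  by rewrite /y; case: (dir_cases (host a)) => ->; case: (dir_cases p) => ->; lia.
move=> eb es; split; first exact: eb.
  rewrite /level eb (negbTE hp) es /y.
  by case: (dir_cases (host a)) => ->; case: (dir_cases p) => ->; lia.
move=> _; rewrite /digit eb (negbTE hp); move: hp; rewrite /host.
by case: ifP => ap hp; case: ifP => h; congr entry; lia.
Qed.

Lemma planted_lt m a : (m < M)%N -> (a < K.+2)%N ->
  (planted m a < K.+1 * (3 * M))%N.
Proof.
move=> mM aK; have hK : (host a <= K)%N by rewrite /host; case: ifP; lia.
have rM := r_lt (host a).
apply: (@leq_trans ((host a).+1 * (3 * M))); last by rewrite leq_mul2r ltnS hK orbT.
rewrite mulSn addnC /planted ltn_add2l; case: ifP => _; first lia.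
by case: (dir_cases (host a)) => ->; case: (dir_cases p) => ->; lia.
Qed.

Lemma planted_copy m : (m < M)%N -> active r m -> copy r (planted m).
Proof.
move=> mM act; split=> [a b /andP[ab bK]|a b aK bK].
  have [ea _ _] := planted_spec mM (ltn_trans ab bK).
  have [eb _ _] := planted_spec mM bK.
  have [h|h] : (host a < host b)%N \/ (host a = p /\ host b = p /\ a = p /\ b = p.+1).
    by rewrite /host; case: ifP; case: ifP; lia.
    by rewrite ltnNge; apply/negP => /block_mono; rewrite ea eb; lia.
  case: h => ha [hb [pa pb]]; rewrite /planted ha hb pa pb !eqxx.
  by rewrite eqn_leq ltnn andbF; lia.
have [_ la da] := planted_spec mM aK; have [_ lb db] := planted_spec mM bK.
by rewrite /hard la lb da // db //; split; lia.
Qed.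

End Planted.

(** * Where copies can lie *)

(** Otherwise the level changes strictly between the two entries, against the order that [s]
    prescribes; only a pair of block [p] escapes this. *)
Lemma copy_same_block r j b : copy r j -> (b < K.+1)%N ->
  block (j b) = b -> block (j b.+1) = b ->
  b = p /\ (slot (j b))./2 = (slot (j b.+1))./2.
Proof.
move=> [jinc jord] bK e1 e2.
have jlt : (j b < j b.+1)%N by apply: jinc; lia.
have e : block (j b) = block (j b.+1) by rewrite e1.
have sl := slot_lt e jlt.
apply: contrapT => h.
have sne : (block (j b) == p -> (slot (j b))./2 < (slot (j b.+1))./2)%N.
  rewrite e1 => /eqP bp; rewrite ltn_neqAle half_leq ?(ltnW sl) // andbT.
  by apply/eqP => hs; apply: h.
have := hard_block_lt r e jlt sne; rewrite e1.
have := entryS_neq bK; case: ifP => h1 h2 h3.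
  by move/jord: h3; lia.
by move/jord: h3; lia.
Qed.

(** If entry [m.+1] failed first, entries [m] and [m.+1] would both lie in block [m], which differs
    from [p]. *)
Lemma copy_block_ge r j m : copy r j -> (m <= p)%N -> (m <= block (j m))%N.
Proof.
move=> cj; elim: m => // m IH mp; rewrite ltnNge; apply/negP => le_m.
have jlt : (j m < j m.+1)%N by apply: cj.1; lia.
have := block_mono (ltnW jlt); have := IH (ltnW mp) => h1 h2.
have [] := @copy_same_block r j m cj; lia.
Qed.

Lemma copy_block_lt r j m : copy r j -> (p < m < K.+2)%N ->
  (block (j m) < m)%N.
Proof.
move=> cj; have [d] := ubnP (K.+2 - m); elim: d m => // d IH m md /andP[pm mK].
have [->|mK1] : m = K.+1 \/ (m.+1 < K.+2)%N by lia.
  by rewrite ltnS block_le.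
rewrite ltnNge; apply/negP => le_m.
have jlt : (j m < j m.+1)%N by apply: cj.1; lia.
have h1 := block_mono (ltnW jlt).
have h2 : (block (j m.+1) < m.+1)%N by apply: IH; lia.
have [] := @copy_same_block r j m cj; lia.
Qed.

Hypothesis extremes : (entry p = 0%N /\ entry p.+1 = K.+1) \/
                      (entry p = K.+1 /\ entry p.+1 = 0%N).

(** The two block bounds squeeze entries [p] and [p.+1] into one pair of block [p]. An inactive pair
    has the wrong order, and an active one takes the least and greatest values of its level, which
    enclose all others. *)
Lemma copy_pair r j : copy r j ->
  [/\ block (j p) = p, active r (slot (j p))./2 &
      forall a, (a < K.+2)%N -> level r (j a) = level r (j p)].
Proof.
move=> cj; have [jinc jord] := cj.
have jlt : (j p < j p.+1)%N by apply: jinc; lia.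
have := block_mono (ltnW jlt).
have := copy_block_ge cj (leqnn p).
have := @copy_block_lt r j p.+1 cj.
move=> h1 h2 h3.
have e1 : block (j p) = p by lia.
have e2 : block (j p.+1) = p by lia.
have [_ eh] := copy_same_block cj pK e1 e2.
have sl : (slot (j p) < slot (j p.+1))%N by apply: slot_lt => //; rewrite e1.
have oddp : odd (slot (j p)) = false /\ odd (slot (j p.+1)) = true by lia.
have elev : level r (j p.+1) = level r (j p) by rewrite /level e1 e2 eqxx eh.
have act : active r (slot (j p))./2.
  apply: contrapT => /negP/negbTE nact.
  have := jord p p.+1; have := jord p.+1 p.
  rewrite /hard elev /digit e1 e2 eqxx oddp.1 oddp.2 -eh nact /=.
  by case: extremes => -[-> ->]; lia.
split=> // a aK; apply: digit_range (digit_ltK r (j a)) _.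
have dp : digit r (j p) = entry p.
  by rewrite /digit e1 eqxx oddp.1 act.
have dp1 : digit r (j p.+1) = entry p.+1.
  by rewrite /digit e2 eqxx oddp.2 -eh act.
have := entry_lt a.
have := jord a p aK (leqW pK); have := jord a p.+1 aK pK.
have := jord p a (leqW pK) aK; have := jord p.+1 a pK aK.
rewrite /hard elev dp dp1.
by case: extremes => -[-> ->]; lia.
Qed.

(** On a single level the [K.+2] digits of a copy are distinct, so every digit occurs, including the
    one that only block [b] hosts. *)
Lemma copy_meets_blocks r j b : copy r j -> (b < K.+1)%N -> b <> p ->
  exists a, [/\ (a < K.+2)%N, block (j a) = b &
                level r (j a) = dir p * (slot (j p))./2%:Z].
Proof.
move=> cj bK bp; have [ep _ lev] := copy_pair cj; have [jinc jord] := cj.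
pose o (a : 'I_K.+2) : 'I_K.+2 := Ordinal (digit_ltK r (j a)).
have o_inj : injective o.
  move=> a c /(congr1 val) /= e.
  have eh : hard r (j a) = hard r (j c) by rewrite /hard e !lev.
  have := jord a c (ltn_ord a) (ltn_ord c); have := jord c a (ltn_ord c) (ltn_ord a).
  rewrite eh ltxx => h1 h2; apply/val_inj/(entry_inj (ltn_ord a) (ltn_ord c)).
  have [lt|lt|//] := ltngtP (entry a) (entry c); first by have := h2.2 lt.
  by have := h1.2 lt.
pose q := (if (b < p)%N then b else b.+1).
have qK : (q < K.+2)%N by rewrite /q; case: ifP; lia.
have [a oa] : exists a, o a = inord (entry q).
  by have [h _ oh] := injF_bij o_inj; exists (h (inord (entry q))); rewrite oh.
exists a; split=> //; last by rewrite lev // /level ep eqxx.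
have {oa} : digit r (j a) = entry q.
  by move/(congr1 val): oa; rewrite /= inordK // entry_lt.
have := block_le (j a).
rewrite /digit; case: eqP => [_|nb] hb.
  by rewrite /q; case: ifP => ?; case: ifP => ? /entry_inj; lia.
by rewrite /q; case: ifP => ?; case: ifP => ? /entry_inj; lia.
Qed.

End HardFunctions.

(** * The hard family: distance from freeness and the count of bad shifts *)

Section HardFamily.
Context (R : realType) (n K : nat) (s : 'S_K.+2) (p M w : nat).
Hypothesis pK : (p < K.+1)%N.
Hypotheses (M0 : (0 < M)%N) (w0 : (0 < w)%N).

Definition shifts (r : {ffun 'I_K.+1 -> 'I_M}) (b : nat) : nat := r (inord b).

Definition hard_fun (r : {ffun 'I_K.+1 -> 'I_M}) (x : 'I_n) : R :=
  (hard s p M w (shifts r) x)%:~R.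

(** Each of the [w] planted copies in the active window must be altered somewhere. Since [w] divides
    [M], the whole window lies below [M]. *)
Lemma hard_fun_far (eps : R) (r : {ffun 'I_K.+1 -> 'I_M}) :
  (w %| M)%N -> (K.+1 * (3 * M) <= n)%N -> eps * n%:R < w%:R ->
  far_from_free s eps (hard_fun r).
Proof.
move=> wM Mn epsw g gfree; apply: lt_le_trans epsw _; rewrite ler_nat.
have r_lt b : (shifts r b < M)%N by exact: ltn_ord.
pose m (e : 'I_w) := (shifts r p %/ w * w + e)%N.
have mM e : (m e < M)%N.
  rewrite -(divnK wM); apply: (@leq_trans ((shifts r p %/ w).+1 * w)).
    by rewrite /m mulSn addnC ltn_add2r.
  by rewrite leq_mul2r ltn_divLR // divnK // r_lt orbT.
have mact e : active p w (shifts r) (m e).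
  by rewrite /active divnMDl // (divn_small (ltn_ord e)) addn0.
pose pos e (a : 'I_K.+2) : 'I_n :=
  Ordinal (leq_trans (planted_lt s pK M0 r_lt (mM e) (ltn_ord a)) Mn).
have /boolp.choice[a aP] : forall e, exists a, hard_fun r (pos e a) != g (pos e a).
  move=> e; apply: contrapT => /forallNP same; apply: gfree.
  have gE a : g (pos e a) = hard_fun r (pos e a).
    by apply/esym/eqP; move/negP: (same a); rewrite negbK.
  have [inc ord] := planted_copy s pK M0 r_lt (mM e) (mact e).
  exists (pos e); split=> [a b ab|a b]; first by apply: inc; rewrite ab /=.
  rewrite !gE /hard_fun ltr_int.
  by have := ord a b (ltn_ord a) (ltn_ord b); rewrite /entry !inord_val.
(* Different [e] give copies on different levels, so the altered points are distinct. *)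
have inj : injective (fun e => pos e (a e)).
  move=> e e' /(congr1 val) /= eq; apply/val_inj.
  have [_ l1 _] := planted_spec s w pK M0 r_lt (mM e) (ltn_ord (a e)).
  have [_ l2 _] := planted_spec s w pK M0 r_lt (mM e') (ltn_ord (a e')).
  move: l2; rewrite -eq l1 /m /=; move: (shifts r p %/ w * w)%N => Z.
  by case: (dir_cases s p) => ->; lia.
rewrite -[leqLHS]card_ord -(card_imset _ inj); apply/subset_leq_card/fintype.subsetP.
by move=> x /imsetP[e _ ->]; exact: aP.
Qed.

Lemma level_inj (r r' : nat -> nat) x : block K M x != p ->
  level s p M r x = level s p M r' x -> r (block K M x) = r' (block K M x).
Proof.
by rewrite /level => /negbTE ->; case: (dir_cases s (block K M x)) => ->; lia.
Qed.

Hypothesis extremes : (entry s p = 0%N /\ entry s p.+1 = K.+1) \/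
                      (entry s p = K.+1 /\ entry s p.+1 = 0%N).

(* The query in block [p] gives the level of the copy, and each other query then
   gives the shift of its block. *)
Lemma hard_fun_bad_shifts (Q : seq 'I_n) :
  (#|[pred r | `[<contains_in s (hard_fun r) Q>]]| <= size Q ^ K.+1 * w)%N.
Proof.
pose bad := [pred r | `[<contains_in s (hard_fun r) Q>]].
pose T := {ffun 'I_K.+1 -> 'I_(size Q)}.
pose at_ (g : T) b : nat := tnth (in_tuple Q) (g b).
pose P (r : {ffun 'I_K.+1 -> 'I_M}) (g : T) :=
  active p w (shifts r) (slot K M (at_ g (inord p)))./2 /\
  forall b : 'I_K.+1, b != p :> nat ->
    block K M (at_ g b) = b /\
    level s p M (shifts r) (at_ g b) =
      dir s p * (slot K M (at_ g (inord p)))./2%:Z.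
have badP (x : {r | bad r}) : exists g, P (val x) g.
  case: x => r /= /asboolP[i [inc ord iQ]].
  pose j a : nat := i (inord a).
  have cj : copy s p M w (shifts r) j.
    split=> [a b /andP[ab bK]|a b aK bK].
      by apply: inc; rewrite !inordK // (ltn_trans ab).
    by rewrite -(ltr_int R); exact: ord.
  have [ep act _] := copy_pair pK M0 extremes cj.
  have idx (b : 'I_K.+1) : exists y : 'I_(size Q),
      if b == p :> nat then tnth (in_tuple Q) y = j p :> nat else
      block K M (tnth (in_tuple Q) y) = b /\
      level s p M (shifts r) (tnth (in_tuple Q) y) =
        dir s p * (slot K M (j p))./2%:Z.
    case: eqP => bp.
      by have /tnthP[y yE] : i (inord p) \in in_tuple Q by []; exists y; rewrite -yE.
    have [a [aK e1 e2]] := copy_meets_blocks pK M0 extremes cj (ltn_ord b) bp.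
    by have /tnthP[y yE] : i (inord a) \in in_tuple Q by []; exists y; rewrite -yE.
  have [g gP] := boolp.choice idx.
  have gp : at_ (finfun g) (inord p) = j p.
    by have := gP (inord p); rewrite /at_ ffunE inordK // eqxx.
  exists (finfun g); rewrite /P gp; split=> // b /negbTE bp.
  by have := gP b; rewrite bp /at_ ffunE.
have [G GP] := boolp.choice badP.
(* The query in block [p] determines the window of the shift of [p]; the residue modulo [w] then
   fixes that shift. *)
pose code x := (G x, Ordinal (ltn_pmod (shifts (val x) p) w0)).
have code_inj : injective code.
  move=> x y [eG er]; apply/val_inj/ffunP => b; apply/val_inj.
  have [actx lx] := GP x; have [acty ly] := GP y; rewrite -eG in acty ly.
  case: (eqVneq (b : nat) p) => [bp|bp].
    have shE (z : {ffun 'I_K.+1 -> 'I_M}) : val (z b) = shifts z p.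
      by rewrite /shifts -bp inord_val.
    rewrite !shE (divn_eq (shifts (val x) p) w) (divn_eq (shifts (val y) p) w) er.
    by move: actx acty; rewrite /active => /eqP <- /eqP <-.
  have [e1 e2] := lx b bp; have [_ e3] := ly b bp.
  have := @level_inj (shifts (val x)) (shifts (val y)) (at_ (G x) b).
  by rewrite e1 e2 e3 /shifts inord_val; apply.
have := leq_card code code_inj.
by rewrite card_sig card_prod card_ffun !card_ord.
Qed.

End HardFamily.

(** * Choice of parameters and the final estimate *)

Lemma extremes_adjacent_entry (K : nat) (s : 'S_K.+2) : extremes_adjacent s ->
  exists2 p : nat, (p < K.+1)%N &
    (entry s p = 0%N /\ entry s p.+1 = K.+1) \/
    (entry s p = K.+1 /\ entry s p.+1 = 0%N).
Proof.
move=> [lo [hi [lo0 hiK]]].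
have := permKV s lo; have := permKV s hi.
move: ((s^-1)%g lo) ((s^-1)%g hi) => a b sb sa ab.
have pvE (c : 'I_K.+2) : entry s c = s c by rewrite /entry inord_val.
have [e|e] : (b = a.+1 :> nat) \/ (a = b.+1 :> nat) by lia.
- exists a; first by have := ltn_ord b; lia.
  by left; rewrite -e !pvE sa sb.
- exists b; first by have := ltn_ord a; lia.
  by right; rewrite -e !pvE sa sb.
Qed.

(** [w] is one more than the floor of [eps * n], and [M] is the largest multiple of [w] up to
    [n / (3 * m.+1)]. The bound on [eps] makes this multiple positive, so rounding down loses less
    than a factor of two. *)
Lemma window_parameters (R : realType) (m n : nat) (eps : R) :
  0 < eps <= (6 * m.+1%:R)^-1 -> 1 <= eps * n%:R ->
  exists w M : nat,
    [/\ [/\ (0 < M)%N, (0 < w)%N & (w %| M)%N],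
        (m.+1 * (3 * M) <= n < m.+1 * (6 * M))%N,
        eps * n%:R < w%:R & w%:R <= 2 * (eps * n%:R)].
Proof.
move=> /andP[eps0 epsle] en1.
have [tle tlt] := andP (truncn_itv (le_trans ler01 en1)).
pose w := (Num.truncn (eps * n%:R)).+1.
have w2 : w%:R <= 2 * (eps * n%:R) by rewrite /w -natr1; lra.
have wn : (w * (3 * m.+1) <= n)%N.
  rewrite -(ler_nat R) natrM (le_trans (ler_wpM2r _ w2)) //.
  have : eps * (6 * m.+1%:R) <= 1.
    by rewrite -ler_pdivlMr ?div1r // mulr_gt0 // ltr0n.
  rewrite natrM; move: (ler0n R n); set N := n%:R; set L := m.+1%:R.
  by nra.
pose L := (n %/ (3 * m.+1))%N.
have wL : (w <= L)%N by rewrite leq_divRL.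
have L1 : (L * (3 * m.+1) <= n)%N by exact: leq_divM.
have L2 : (n < L.+1 * (3 * m.+1))%N by rewrite ltn_ceil.
have ML : (L %/ w * w <= L)%N by exact: leq_divM.
have MwL : (L < (L %/ w).+1 * w)%N by rewrite ltn_ceil.
have q0 : (0 < L %/ w)%N by rewrite divn_gt0.
exists w, (L %/ w * w)%N; split=> //; last by nia.
by split=> //; [rewrite muln_gt0 q0 | exact: dvdn_mull].
Qed.

(** The power [k - 1] from the counting bound clears the fractional exponents. *)
Lemma query_bound_exprn (R : realType) (m n : nat) (eps c : R) :
  0 < eps -> (0 < n)%N ->
  (c * (eps `^ (- (1 / (m.+2%:R - 1))) * n%:R `^ (1 - 1 / (m.+2%:R - 1)))) ^+ m.+1
    = c ^+ m.+1 * (eps^-1 * n%:R ^+ m).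
Proof.
move=> eps0 n0; have -> : m.+2%:R - 1 = m.+1%:R :> R by rewrite -natr1 addrK.
have m0 : m.+1%:R != 0 :> R by rewrite pnatr_eq0.
have powE (a x : R) : (a `^ x) ^+ m.+1 = a `^ (x * m.+1%:R).
  by rewrite -powR_mulrn ?powR_ge0 // -powRrM.
rewrite !exprMn !powE mulNr div1r mulVf // powR_inv1 ?ltW //; congr (_ * (_ * _)).
by rewrite mulrBl mul1r mulVf // -natr1 addrK powR_mulrn.
Qed.

Theorem theorem3p2 (R : realType) (k : nat) (hk : (3 <= k)%N) :
  exists c eps0 : R,
    [/\ 0 < c, 0 < eps0 &
      forall s : 'S_k, extremes_adjacent s ->
      forall (n : nat) (eps : R), 0 < eps <= eps0 -> 1 <= eps * n%:R ->
      forall t : nonadaptive_test R n, one_sided_test s eps t ->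
        ((c * (eps `^ (- (1 / (k%:R - 1)))
               * n%:R `^ (1 - 1 / (k%:R - 1))))%:E
          <= query_complexity t)%E].
Proof.
case: k hk => [|[|[|m]]] // _; set K := m.+1.
have K0 : 0 < K.+1%:R :> R by rewrite ltr0n.
(* As [n < 6 * K.+1 * M], the factor 18 gives [c * n <= M / 3]; the second constant is the bound of
   [window_parameters]. *)
exists (18 * K.+1%:R)^-1, (6 * K.+1%:R)^-1.
split; rewrite ?invr_gt0 ?mulr_gt0 // => s /extremes_adjacent_entry[p pK ext].
move=> n eps epsP en1 t tP; have /andP[eps0 _] := epsP.
have n0 : (0 < n)%N by case: n en1 {t tP} => //; rewrite mulr0 ler10.
have [w [M [[M0 w0 wM] /andP[Mn nM] epsw w2]]] := window_parameters epsP en1.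
set c := (18 * K.+1%:R)^-1; set X := c * _; rewrite leNgt; apply/negP => ltX.
have sizeX (z : coin t) : (size (queries z))%:R <= X.
  rewrite -lee_fin (le_trans _ (ltW ltX)) //.
  by apply: ereal_sup_ubound; exists z.
have c0 : 0 <= c by rewrite invr_ge0 mulr_ge0.
have X0 : 0 <= X by rewrite !mulr_ge0 ?powR_ge0.
have avg : 2 / 3 * #|{ffun 'I_K.+1 -> 'I_M}|%:R <= X ^+ K.+1 * w%:R.
  apply: (@far_family_averaging R n K.+2 s eps t isT tP _
    (@hard_fun R n K s p M w) (X ^+ K.+1 * w%:R)) => [r|z].
    exact: hard_fun_far.
  have := hard_fun_bad_shifts R pK M0 w0 ext (queries z).
  rewrite -(ler_nat R) natrM natrX => /le_trans; apply.
  by rewrite ler_wpM2r // lerXn2r ?nnegrE.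
move: avg; rewrite card_ffun !card_ord natrX query_bound_exprn //.
have cn : c * n%:R <= M%:R / 3.
  rewrite /c mulrC ler_pdivrMr ?mulr_gt0 //.
  have : n%:R <= K.+1%:R * (6 * M%:R) :> R by rewrite -!natrM ler_nat ltnW.
  by lra.
have cnM : (c * n%:R) ^+ K.+1 <= (M%:R / 3) ^+ K.+1.
  by rewrite lerXn2r ?nnegrE ?mulr_ge0 ?divr_ge0.
have cX0 : 0 <= c ^+ K.+1 * (eps^-1 * n%:R ^+ K).
  by apply/mulr_ge0/mulr_ge0; rewrite ?exprn_ge0 ?invr_ge0 ?(ltW eps0).
move=> /le_trans/(_ (ler_wpM2l cX0 w2)).
have -> : c ^+ K.+1 * (eps^-1 * n%:R ^+ K) * (2 * (eps * n%:R)) =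
    2 * (c * n%:R) ^+ K.+1.
  by rewrite exprMn [n%:R ^+ K.+1]exprSr; field; rewrite gt_eqF.
(* Here [k >= 3] enters: averaging would give 2/3 of [M ^ K.+1] at most 2/9 of it. *)
have third : 3^-1 ^+ K.+1 <= 3^-1 ^+ 2 :> R.
  by rewrite ler_wiXn2l // ?invr_ge0 // invf_le1 // ler1n.
have MK : 0 < M%:R ^+ K.+1 :> R by rewrite exprn_gt0 // ltr0n.
have cnA := le_trans cnM (_ : _ <= M%:R ^+ K.+1 * 3^-1 ^+ 2).
rewrite exprMn ler_pM2l // in cnA; move: MK (cnA third).
set A := M%:R ^+ K.+1; set B := (c * _) ^+ K.+1.
by lra.
Qed.
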